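(* For integers $m>2$, let $\Lambda_m\subset G$ be the lattices, in the fixed $8$-dimensional simply connected solvable Lie group $G$, defined in the context. Then the solvmanifolds $\Lambda_m\backslash G$ ($m\in\mathbb N$, $m>2$) are pairwise non-homeomorphic; that is, if $m,n>2$ are integers with $m\neq n$, then $\Lambda_m\backslash G$ and $\Lambda_n\backslash G$ are not homeomorphic.
   Context: Definition of $G$. For $t\in\mathbb R$ let $\varphi(t)=\operatorname{diag}(e^t,e^{-t},1,e^t,e^{-t},1)\in GL(6,\mathbb R)$ and let $H=\mathbb R\ltimes_\varphi\mathbb R^6$, with product $(t,v)(t',v')=(t+t',\,v+\varphi(t)v')$. For $s\in\mathbb R$ let $R(s)\in GL(6,\mathbb R)$ be the rotation by angle $s$ in the plane of the first and fourth coordinates, fixing the other coordinates: $R(s)(x_1,\dots,x_6)=(x_1\cos s-x_4\sin s,\ x_2,\ x_3,\ x_1\sin s+x_4\cos s,\ x_5,\ x_6)$. It commutes with every $\varphi(t)$, and $\psi(s)(t,v)=(t,R(s)v)$ is an automorphism of $H$. Set $G=\mathbb R\ltimes_\psi H$, with product $(s,h)(s',h')=(s+s',\,h\,\psi(s)(h'))$. (Its Lie algebra has basis $e_1,\dots,e_8$ with non-zero brackets $[e_1,e_3]=e_3$, $[e_2,e_3]=e_4$, $[e_1,e_6]=-e_6$, $[e_1,e_4]=e_4$, $[e_2,e_4]=-e_3$, $[e_1,e_7]=-e_7$; the factor $\mathbb R^6$ has ordered basis $\{e_3,e_6,e_5,e_4,e_7,e_8\}$, the $t$-factor is generated by $e_1$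 and the $s$-factor by $e_2$.) Definition of $\Lambda_m$. For an integer $m>2$ let $t_m=\operatorname{arccosh}(m/2)>0$, so that $e^{t_m}+e^{-t_m}=m$. Let $$Q_m=\begin{pmatrix}1&e^{t_m}&e^{2t_m}\\1&e^{-t_m}&e^{-2t_m}\\1&1&1\end{pmatrix},\qquad P_m=\begin{pmatrix}Q_m&0\\0&Q_m\end{pmatrix}.$$ Then $P_m^{-1}\varphi(t_m)P_m$ is an integer matrix, $\Gamma_m=t_m\mathbb Z\ltimes P_m\mathbb Z^6=\{(t,v)\in H: t\in t_m\mathbb Z,\ v\in P_m\mathbb Z^6\}$ is a lattice (discrete cocompact subgroup) in $H$, and, since $\psi(2\pi)=\operatorname{Id}$, $$\Lambda_m=2\pi\mathbb Z\ltimes\Gamma_m=\{(s,h)\in G: s\in2\pi\mathbb Z,\ h\in\Gamma_m\}$$ is a lattice in $G$. $\Lambda_m\backslash G$ denotes the quotient of $G$ by the left action of $\Lambda_m$. *)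

(* Defs.v *)
From HB Require Import structures.
From mathcomp Require Import all_boot all_order all_algebra.
From mathcomp Require Import all_classical all_reals all_analysis.
From mathcomp Require Import ring lra.

Set Implicit Arguments.
Unset Strict Implicit.
Unset Printing Implicit Defensive.

Import Order.TTheory GRing.Theory Num.Theory.
Import numFieldNormedType.Exports.

Local Open Scope classical_set_scope.
Local Open Scope ring_scope.
Local Open Scope quotient_scope.

Section hyperbolic.
Variable R : realType.
Implicit Types x y : R.

Definition cosh x : R := (expR x + expR (- x)) / 2.

(* The inverse of cosh restricted to the nonnegative reals (see arcosh_def);
   the value is arbitrary for x < 1. *)
Definition arcosh x : R := get [set y | 0 <= y /\ cosh y = x].

Lemma arcosh_def x : 1 <= x -> 0 <= arcosh x /\ cosh (arcosh x) = x.
Proof.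
move=> x1; rewrite /arcosh; case: xgetP => //= He; exfalso.
have x2 : 0 <= x ^+ 2 - 1 by nra.
set q := Num.sqrt (x ^+ 2 - 1).
have q0 : 0 <= q by exact: sqrtr_ge0.
have qE : q ^+ 2 = x ^+ 2 - 1 by rewrite sqr_sqrtr.
have xq : 0 < x + q by lra.
apply: (He (ln (x + q))); split; first by apply: ln_ge0; lra.
rewrite /cosh expRN lnK ?posrE//.
have -> : (x + q)^-1 = x - q.
  apply: (mulfI (lt0r_neq0 xq)); rewrite divff ?lt0r_neq0//.
  have -> : (x + q) * (x - q) = x ^+ 2 - q ^+ 2 by ring.
  by rewrite qE; ring.
by field.
Qed.

Definition tm (m : nat) : R := arcosh (m%:R / 2).

Lemma tmE (m : nat) : (2 < m)%N ->
  0 < tm m /\ expR (tm m) + expR (- tm m) = m%:R.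
Proof.
move=> m2; have m2R : (2 : R) < m%:R by rewrite ltr_nat.
have [t0 tE] : 0 <= tm m /\ cosh (tm m) = m%:R / 2 by apply: arcosh_def; lra.
have eqm : expR (tm m) + expR (- tm m) = m%:R by move: tE; rewrite /cosh; lra.
split=> //; rewrite lt_neqAle t0 andbT; apply/eqP => t0E.
by move: eqm m2R; rewrite -t0E oppr0 expR0; lra.
Qed.

End hyperbolic.

Section matrices.
Variable R : realType.

Definition phi (t : R) : 'M[R]_6 :=
  diag_mx (\row_(i < 6)
    [:: expR t; expR (- t); 1; expR t; expR (- t); 1]`_i).

(* Indices start at 0, so the rotated plane, that of the first and fourth
   coordinates, has indices 0 and 3. *)
Definition rot (s : R) : 'M[R]_6 := \matrix_(i < 6, j < 6)
  (nth [::] [:: [:: cos s; 0; 0; - sin s; 0; 0];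
                [:: 0;     1; 0; 0;       0; 0];
                [:: 0;     0; 1; 0;       0; 0];
                [:: sin s; 0; 0; cos s;   0; 0];
                [:: 0;     0; 0; 0;       1; 0];
                [:: 0;     0; 0; 0;       0; 1]] i)`_j.

Definition Qm (m : nat) : 'M[R]_3 := \matrix_(i < 3, j < 3)
  (nth [::] [:: [:: 1; expR (tm R m);   expR (2 * tm R m)];
                [:: 1; expR (- tm R m); expR (- (2 * tm R m))];
                [:: 1; 1;               1]] i)`_j.

Definition Pm (m : nat) : 'M[R]_6 := block_mx (Qm m) 0 0 (Qm m) : 'M[R]_(3 + 3).

Lemma phi0 : phi 0 = 1%:M.
Proof.
rewrite /phi oppr0 expR0 -diag_const_mx; congr diag_mx.
by apply/rowP; case=> [[|[|[|[|[|[|//]]]]]] i6]; rewrite !mxE.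
Qed.

Lemma phiD t u : phi (t + u) = phi t *m phi u.
Proof.
rewrite /phi mulmx_diag; congr diag_mx; apply/rowP => i; rewrite !mxE.
by case: i => [[|[|[|[|[|[|//]]]]]] i6] /=;
  rewrite ?mulr1 ?opprD ?expRD.
Qed.

Lemma rot0 : rot 0 = 1%:M.
Proof.
by apply/matrixP => -[[|[|[|[|[|[|//]]]]]] ?] [[|[|[|[|[|[|//]]]]]] ?];
  rewrite !mxE/= ?cos0 ?sin0 ?oppr0.
Qed.

Lemma rotD s r : rot (s + r) = rot s *m rot r.
Proof.
by apply/matrixP => -[[|[|[|[|[|[|//]]]]]] ?] [[|[|[|[|[|[|//]]]]]] ?];
  rewrite !mxE !big_ord_recl big_ord0 !mxE/= ?cosD ?sinD; ring.
Qed.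

Lemma rot2pi : rot (2 * pi) = 1%:M.
Proof.
rewrite -rot0; apply/matrixP => i j; rewrite !mxE mulr_natl.
by rewrite cos2pi sin2pi cos0 sin0.
Qed.

Lemma phi_rotC t s : phi t *m rot s = rot s *m phi t.
Proof.
rewrite mul_diag_mx mul_mx_diag.
by apply/matrixP => -[[|[|[|[|[|[|//]]]]]] ?] [[|[|[|[|[|[|//]]]]]] ?];
  rewrite !mxE/= ?mulr0 ?mul0r ?mulr1 ?mul1r// mulrC.
Qed.

End matrices.

Section H.
Variable R : realType.

(* Elements are pairs (t, v). *)
Definition H : Type := (R * 'cV[R]_6)%type.

Definition mulH (x y : H) : H := (x.1 + y.1, x.2 + phi x.1 *m y.2).
Definition oneH : H := (0, 0).
Definition invH (x : H) : H := (- x.1, - (phi (- x.1) *m x.2)).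

Lemma mulHA : associative mulH.
Proof.
move=> x y z; rewrite /mulH/= addrA; congr (_, _).
by rewrite mulmxDr mulmxA phiD addrA.
Qed.

Lemma mul1H : left_id oneH mulH.
Proof. by case=> t v; rewrite /mulH/= phi0 mul1mx !add0r. Qed.

Lemma mulH1 : right_id oneH mulH.
Proof. by case=> t v; rewrite /mulH/= mulmx0 !addr0. Qed.

Lemma mulVH : left_inverse oneH invH mulH.
Proof. by case=> t v; rewrite /mulH/= !addNr. Qed.

Lemma mulHV : right_inverse oneH invH mulH.
Proof.
case=> t v; rewrite /mulH/= mulmxN mulmxA -phiD !subrr phi0 mul1mx.
by rewrite subrr.
Qed.

HB.instance Definition _ := Topological.copy H (R * 'cV[R]_6)%type.
HB.instance Definition _ := isGroup.Build H mulHA mul1H mulH1 mulVH mulHV.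

Definition psi (s : R) (x : H) : H := (x.1, rot s *m x.2).

Lemma psi0 x : psi 0 x = x.
Proof. by case: x => t v; rewrite /psi/= rot0 mul1mx. Qed.

Lemma psiD s r x : psi (s + r) x = psi s (psi r x).
Proof. by rewrite /psi/= rotD mulmxA. Qed.

Lemma psiM s : {morph psi s : x y / (x * y)%g}.
Proof.
move=> x y; congr (_, _) => /=.
by rewrite mulmxDr !mulmxA phi_rotC.
Qed.

Lemma psi1 s : psi s 1%g = 1%g.
Proof. by congr (_, _); rewrite /= mulmx0. Qed.

End H.

Section G.
Variable R : realType.

(* Elements are pairs (s, (t, v)). *)
Definition G : Type := (R * H R)%type.

Definition mulG (x y : G) : G := (x.1 + y.1, (x.2 * psi x.1 y.2)%g).
Definition oneG : G := (0, 1%g).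
Definition invG (x : G) : G := (- x.1, psi (- x.1) (x.2^-1)%g).

Lemma mulGA : associative mulG.
Proof.
move=> x y z; rewrite /mulG/= addrA; congr (_, _).
by rewrite psiM psiD mulgA.
Qed.

Lemma mul1G : left_id oneG mulG.
Proof. by case=> s h; rewrite /mulG/= psi0 add0r mul1g. Qed.

Lemma mulG1 : right_id oneG mulG.
Proof. by case=> s h; rewrite /mulG/= psi1 addr0 mulg1. Qed.

Lemma mulVG : left_inverse oneG invG mulG.
Proof. by case=> s h; rewrite /mulG/= addNr -psiM mulVg psi1. Qed.

Lemma mulGV : right_inverse oneG invG mulG.
Proof. by case=> s h; rewrite /mulG/= subrr -psiD subrr psi0 mulgV. Qed.

HB.instance Definition _ := Topological.copy G (R * H R)%type.
HB.instance Definition _ := isGroup.Build G mulGA mul1G mulG1 mulVG mulGV.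

End G.

Section lattices.
Variable R : realType.

Definition Gamma (m : nat) : set (H R) := [set x |
  (exists k : int, x.1 = k%:~R * tm R m) /\
  (exists z : 'cV[int]_6, x.2 = Pm R m *m map_mx intr z)].

Definition Lambda (m : nat) : set (G R) := [set x |
  (exists k : int, x.1 = k%:~R * (2 * pi)) /\ Gamma m x.2].

Let D (t : R) : 'M[R]_3 := diag_mx (\row_(i < 3) [:: expR t; expR (- t); 1]`_i).

Let phi_block t : phi t = block_mx (D t) 0 0 (D t) :> 'M[R]_(3 + 3).
Proof.
rewrite [RHS](_ : _ = diag_mx (row_mx
  (\row_(i < 3) [:: expR t; expR (- t); 1]`_i)
  (\row_(i < 3) [:: expR t; expR (- t); 1]`_i))); last by rewrite diag_mx_row.
congr diag_mx; apply/rowP => i; rewrite !mxE.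
case: splitP => j ij; rewrite !mxE ij.
  by case: j {ij} => [[|[|[|//]]] ?].
by case: j {ij} => [[|[|[|//]]] ?].
Qed.

(* The matrices of multiplication by X and by X^-1 in the basis 1, X, X^2 of
   Z[X] / ((X^2 - m X + 1) (X - 1)), whose roots are e^t, e^-t and 1 for
   t = tm m. *)
Let C (m : nat) : 'M[int]_3 := \matrix_(i < 3, j < 3)
  (nth [::] [:: [:: 0; 0; 1]; [:: 1; 0; - m.+1%:Z]; [:: 0; 1; m.+1%:Z]] i)`_j.
Let C' (m : nat) : 'M[int]_3 := \matrix_(i < 3, j < 3)
  (nth [::] [:: [:: m.+1%:Z; 1; 0]; [:: - m.+1%:Z; 0; 1]; [:: 1; 0; 0]] i)`_j.

Let DQ m : (2 < m)%N -> D (tm R m) *m Qm R m = Qm R m *m map_mx intr (C m).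
Proof.
move=> /(tmE R)[_]; have := expRxMexpNx_1 (tm R m).
rewrite mul_diag_mx => E1 E2.
have E3 : expR (2 * tm R m) = expR (tm R m) ^+ 2 by rewrite expRM_natl.
have E4 : expR (- (2 * tm R m)) = expR (- tm R m) ^+ 2.
  by rewrite -mulrN expRM_natl.
apply/matrixP => -[[|[|[|//]]] ?] [[|[|[|//]]] ?];
  rewrite !mxE !big_ord_recl big_ord0 !mxE/= ?rmorphN/= ?E3 ?E4 -?pmulrn;
  rewrite -?[in m.+1%:R]natr1 -?E2;
  move: (expR (tm R m)) (expR (- tm R m)) E1 => a b E1; by ring: E1.
Qed.

Let DQ' m : (2 < m)%N -> D (- tm R m) *m Qm R m = Qm R m *m map_mx intr (C' m).
Proof.
move=> /(tmE R)[_]; have := expRxMexpNx_1 (tm R m).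
rewrite mul_diag_mx => E1 E2.
have E3 : expR (2 * tm R m) = expR (tm R m) ^+ 2 by rewrite expRM_natl.
have E4 : expR (- (2 * tm R m)) = expR (- tm R m) ^+ 2.
  by rewrite -mulrN expRM_natl.
apply/matrixP => -[[|[|[|//]]] ?] [[|[|[|//]]] ?];
  rewrite !mxE !big_ord_recl big_ord0 !mxE/= ?opprK ?rmorphN/= ?E3 ?E4 -?pmulrn;
  rewrite -?[in m.+1%:R]natr1 -?E2;
  move: (expR (tm R m)) (expR (- tm R m)) E1 => a b E1; by ring: E1.
Qed.

Let phiP_block (t : R) m (A : 'M[int]_3) :
  D t *m Qm R m = Qm R m *m map_mx intr A ->
  phi t *m Pm R m =
  Pm R m *m map_mx intr (block_mx A 0 0 A : 'M[int]_(3 + 3)).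
Proof.
move=> DQA.
have bl (X Y : 'M[R]_3) : block_mx X 0 0 X *m block_mx Y 0 0 Y =
    block_mx (X *m Y) 0 0 (X *m Y).
  by rewrite mulmx_block !mul0mx !mulmx0 !addr0 !add0r.
have := bl (Qm R m) (map_mx intr A); rewrite -DQA -bl.
rewrite map_block_mx map_mx0 phi_block; exact: esym.
Qed.

Lemma phiPm m (k : int) : (2 < m)%N ->
  exists A : 'M[int]_6,
    phi (k%:~R * tm R m) *m Pm R m = Pm R m *m map_mx intr A.
Proof.
move=> m2.
have step (t u : R) :
    (exists A : 'M[int]_6, phi t *m Pm R m = Pm R m *m map_mx intr A) ->
    (exists A : 'M[int]_6, phi u *m Pm R m = Pm R m *m map_mx intr A) ->
    exists A : 'M[int]_6, phi (t + u) *m Pm R m = Pm R m *m map_mx intr A.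
  move=> [A tA] [B uB]; exists (A *m B).
  by rewrite phiD -mulmxA uB mulmxA tA -mulmxA map_mxM.
elim: k => [|n IH|n IH].
- by exists 1%:M; rewrite mul0r phi0 map_mx1 mulmx1 mul1mx.
- rewrite intS rmorphD/= mulrDl mul1r; apply: step => //.
  by eexists; apply: phiP_block; exact: DQ.
- rewrite intS opprD rmorphD/= mulrDl mulN1r; apply: step => //.
  by eexists; apply: phiP_block; exact: DQ'.
Qed.

Lemma rot2piz (k : int) : rot (k%:~R * (2 * pi)) = 1%:M :> 'M[R]_6.
Proof.
have rotN : rot (- (2 * pi)) = 1%:M :> 'M[R]_6.
  by rewrite -[LHS]mulmx1 -[X in _ *m X]rot2pi -rotD addNr rot0.
elim: k => [|n IH|n IH]; first by rewrite mul0r rot0.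
- by rewrite intS rmorphD/= mulrDl mul1r rotD rot2pi mul1mx.
- by rewrite intS opprD rmorphD/= mulrDl mulN1r rotD rotN mul1mx.
Qed.

Lemma Gamma_group m : (2 < m)%N ->
  [/\ Gamma m 1%g, forall x, Gamma m x -> Gamma m x^-1%g &
      forall x y, Gamma m x -> Gamma m y -> Gamma m (x * y)%g].
Proof.
move=> m2; split.
- by split; [exists 0; rewrite mul0r | exists 0; rewrite map_mx0 mulmx0].
- move=> [_ _] [/= [k ->] [z ->]].
  split; first by exists (- k); rewrite /= rmorphN mulNr.
  have [A kA] := phiPm (- k) m2; exists (- (A *m z)).
  by rewrite /= -mulNr -rmorphN/= mulmxA kA -mulmxA map_mxN mulmxN map_mxM.
- move=> [_ _] [_ _] [/= [k ->] [z ->]] [/= [l ->] [w ->]].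
  split; first by exists (k + l); rewrite /= rmorphD mulrDl.
  have [A kA] := phiPm k m2; exists (z + A *m w).
  by rewrite /= mulmxA kA -mulmxA map_mxD mulmxDr map_mxM.
Qed.

Let psi2piz (k : int) (x : H R) : psi (k%:~R * (2 * pi)) x = x.
Proof. by case: x => t v; rewrite /psi rot2piz mul1mx. Qed.

Lemma Lambda_group m : (2 < m)%N -> group_closed [in @Lambda m].
Proof.
move=> m2; have [G1 GV GM] := Gamma_group m2.
split=> [|x y]; rewrite !inE.
  by split=> //; exists 0; rewrite mul0r.
case: x y => [_ h] [_ h'] [[k /= ->] hG] [[l /= ->] h'G].
split; first by exists (k - l); rewrite /= rmorphB mulrBl.
rewrite /= psi2piz -mulNr -rmorphN psi2piz.
by apply: GM => //; exact: GV.
Qed.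

End lattices.

Section left_quotient.
Variables (R : realType) (L : set (G R)) (L_group : group_closed [in L]).

(* x and y are in the same orbit of the action of L by left translations. *)
Definition lact_rel (x y : G R) := `[< exists2 l, L l & y = (l * x)%g >].

Lemma lact_refl : reflexive lact_rel.
Proof.
move=> x; apply/asboolP; exists 1%g; last by rewrite mul1g.
by have [] := L_group; rewrite inE.
Qed.

Lemma lact_sub x y : lact_rel x y -> lact_rel y x.
Proof.
move=> /asboolP[l Ll ->]; apply/asboolP; exists l^-1%g; last by rewrite mulKg.
have := group_closedV L_group; rewrite /invg_closed => /(_ l).
by rewrite !inE; exact.
Qed.

Lemma lact_sym : symmetric lact_rel.
Proof. by move=> x y; apply/idP/idP; exact: lact_sub. Qed.

Lemma lact_trans : transitive lact_rel.
Proof.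
move=> y x z /asboolP[l Ll ->] /asboolP[k Lk ->]; apply/asboolP.
exists (k * l)%g; last by rewrite mulgA.
have := group_closedM L_group; rewrite /mulg_closed => /(_ k l).
by rewrite !inE; exact.
Qed.

Definition lact : equiv_rel (G R) :=
  EquivRel lact_rel lact_refl lact_sym lact_trans.

Definition lquot := quotient_topology {eq_quot lact}.

HB.instance Definition _ := Topological.on lquot.
HB.instance Definition _ := Quotient.on lquot.

Lemma lquotP (x y : G R) :
  \pi_lquot x = \pi_lquot y <-> exists2 l, L l & y = (l * x)%g.
Proof.
have eqP := @eqmodP _ lact x y.
by split=> [/eqP/asboolP|xy]; [|apply/eqP/asboolP].
Qed.

End left_quotient.

Definition solvmanifold (R : realType) (m : nat) (m_gt2 : (2 < m)%N) :
  topologicalType := lquot (Lambda_group R m_gt2).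

Definition homeomorphic (T U : topologicalType) : Prop :=
  exists (f : T -> U) (g : U -> T),
    [/\ continuous f, continuous g, cancel f g & cancel g f].

(* Main.v *)
Require Import Defs.
From mathcomp Require Import all_boot all_order all_algebra.
From mathcomp Require Import all_classical all_reals all_analysis.
From mathcomp Require Import ring lra.

Set Implicit Arguments.
Unset Strict Implicit.
Unset Printing Implicit Defensive.

Import Order.TTheory GRing.Theory Num.Theory.
Import numFieldNormedType.Exports.

Local Open Scope classical_set_scope.
Local Open Scope ring_scope.
Local Open Scope quotient_scope.

(** Both solvmanifolds are quotients of the contractible group G = R^8 by a
    discrete group of left translations, so G is their universal covering and
    the deck groups are the lattices. A homeomorphism f of the quotients lifts
    to a continuous F : G -> G (lift_homotopy, applied to the radial
    contraction of G), and F (l x) = theta (l) F x defines a homomorphism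
    theta between the lattices (equivariant_lift). The inverse of f lifts in
    the same way, and the composite of the two lifts is a deck translation;
    hence theta is onto (homeomorphic_lquot).

    The lattices are then told apart algebraically. Since R (2 pi k) = 1, an
    element of Lambda_m acts by conjugation on the vectors of the lattice as
    phi (j t_m) for some integer j. The commutators of Lambda_m are vectors
    with vanishing third and sixth coordinates, on which phi (t_m) has only
    the eigenvalues e^t_m and e^-t_m, the roots of X^2 - m X + 1. So there is
    a g in Lambda_m such that (g^2 c g^-2) c = (g c g^-1)^m for every
    commutator c (gen_t_charpoly). An epimorphism carries this property to
    Lambda_n, where g becomes an element acting as phi (j t_n) for some j, and
    a commutator with nonzero first coordinate yields
    e^(2 j t_n) + 1 = m e^(j t_n), that is m = 2 cosh (j t_n). As m > 2, j is
    not 0, and then m >= 2 cosh t_n = n (Lambda_epi_leq). The same argument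
    for the inverse homeomorphism gives n >= m. *)

(** * Lifting through regular coverings *)

(** Compactness of [0, 1] in the form used below: a relation between the ends
    of subintervals that can be concatenated and holds on all short intervals
    holds on [0, 1]. The supremum of the x such that Q 0 x is attained and is
    equal to 1. *)
Lemma segment_chain (R : realType) (Q : R -> R -> Prop) :
  (forall a b c, a <= b -> b <= c -> Q a b -> Q b c -> Q a c) ->
  (forall t, 0 <= t <= 1 -> exists2 e, 0 < e &
     forall a b, 0 <= a -> a <= b -> b <= 1 -> t - e < a -> b < t + e ->
     Q a b) ->
  Q 0 1.
Proof.
move=> Qtrans Qloc.
pose S := [set x | [/\ 0 <= x, x <= 1 & Q 0 x]].
have S0 : S 0.
  have [e e0 He] : exists2 e, 0 < e & forall a b, 0 <= a -> a <= b -> b <= 1 ->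
      0 - e < a -> b < 0 + e -> Q a b by apply: Qloc; lra.
  by split=> //; apply: He; lra.
have hS : has_sup S by split; [exists 0 | exists 1 => x []].
have s0 : 0 <= sup S by apply: ub_le_sup => //; case: hS.
have s1 : sup S <= 1 by apply: ge_sup; [exists 0 | move=> x []].
have [e e0 He] : exists2 e, 0 < e & forall a b, 0 <= a -> a <= b -> b <= 1 ->
    sup S - e < a -> b < sup S + e -> Q a b by apply: Qloc; rewrite s0 s1.
have [a [a0 a1 Qa] ea] := sup_adherent e0 hS.
have as_ : a <= sup S by apply: ub_le_sup => //; case: hS.
have step b : a <= b -> b <= 1 -> b < sup S + e -> Q 0 b.
  by move=> ab b1 be; apply: (Qtrans 0 a b) => //; apply: He.
have [s1'|s1'] := leP 1 (sup S); first by apply: step => //; lra.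
have [lt1|ge1] := leP 1 (sup S + e / 2); first by apply: step => //; lra.
have : sup S + e / 2 <= sup S.
  apply: ub_le_sup; first by case: hS.
  by split; [lra|lra|apply: step; lra].
by lra.
Qed.

Lemma hausdorff_neq_near (X E : topologicalType) (L L' : X -> E) x :
  hausdorff_space E -> {for x, continuous L} -> {for x, continuous L'} ->
  L x <> L' x -> \forall y \near x, L y <> L' y.
Proof.
rewrite open_hausdorff => E2 cL cL' /eqP /E2[[U V] /= [Ux Vx] [Uo Vo UV]].
have nU : \forall y \near x, U (L y).
  by apply: cL; apply: open_nbhs_nbhs; split=> //; rewrite inE in Ux.
have nV : \forall y \near x, V (L' y).
  by apply: cL'; apply: open_nbhs_nbhs; split=> //; rewrite inE in Vx.
apply: filterS2 nU nV => y Uy Vy yy.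
have : (U `&` V) (L y) by split => //; rewrite yy.
by rewrite (eqP UV).
Qed.

Section covering.
Variables (E B : topologicalType) (p : E -> B).

(** The covering is described by its deck transformations, which are
    transitive on the fibres: a local section through one point of a fibre can
    be moved to any other point of it, so evenly covered neighbourhoods need
    not be mentioned. *)
Record regular_covering : Prop := RegularCovering {
  cover_continuous : continuous p;
  cover_open : forall U, open U -> open (p @` U);
  cover_surj : forall b, exists e, p e = b;
  cover_inj : forall e : E, \forall u \near (e, e), p u.1 = p u.2 -> u.1 = u.2;
  cover_deck : forall e e', p e = p e' ->
    exists D : E -> E, [/\ continuous D, forall u, p (D u) = p u & D e = e'];
  cover_hausdorff : hausdorff_space E }.

Definition lifts_at (X : topologicalType) (h : X -> B) (L : X -> E) (x : X) :=
  p (L x) = h x /\ {for x, continuous L}.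

Hypothesis pcov : regular_covering.

(** On a neighbourhood U of e0 where p is injective, the lift is the local
    inverse of p composed with h; it is continuous because p is open. *)
Lemma local_lift (X : topologicalType) (h : X -> B) (x0 : X) (e0 : E) :
  continuous h -> p e0 = h x0 ->
  exists L : X -> E, L x0 = e0 /\ \forall x \near x0, lifts_at h L x.
Proof.
move=> hc pe0.
have [[U1 U2] [/= U1e U2e] Uinj] := cover_inj pcov e0.
have [U [Uo Ue UU]] : exists U, [/\ open U, U e0 & U `<=` U1 `&` U2].
  have : nbhs e0 (U1 `&` U2) by apply: filterI.
  by rewrite nbhsE => -[U [Uo Ue] UU]; exists U.
have Ui u v : U u -> U v -> p u = p v -> u = v.
  move=> Uu Uv puv; apply: (Uinj (u, v)) => //=.
  by split; [have [] := UU _ Uu | have [] := UU _ Uv].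
pose L x := xget e0 [set u | U u /\ p u = h x].
have LP u x : U u -> p u = h x -> L x = u.
  move=> Uu pu; rewrite /L; case: xgetP => [v _ [Uv pv]|/(_ u)[]//].
  by apply: Ui => //; rewrite pv.
exists L; split; first exact: LP.
have hp V : open V -> forall x, (p @` V) (h x) ->
    \forall x' \near x, (p @` V) (h x').
  move=> Vo x Vx; apply: (hc x); apply: open_nbhs_nbhs.
  by split=> //; exact: cover_open.
have hU : (p @` U) (h x0) by exists e0.
apply: filterS (hp U Uo x0 hU) => x [u Uu pu].
split; first by rewrite (LP u).
move=> V; rewrite {1}nbhsE => -[W [Wo WL] WV].
have : (p @` (U `&` W)) (h x).
  by exists u => //; split => //; rewrite -(LP u x).
move=> /(hp _ (openI Uo Wo)); apply: filterS => x' [v [Uv Wv] pv] /=.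
by apply: WV; rewrite (LP v).
Qed.

Lemma lifts_eq_near (X : topologicalType) (h : X -> B) (L L' : X -> E) x :
  (\forall y \near x, lifts_at h L y) -> (\forall y \near x, lifts_at h L' y) ->
  L x = L' x -> \forall y \near x, L y = L' y.
Proof.
move=> lL lL' LL'.
have cL := (nbhs_singleton lL).2; have cL' := (nbhs_singleton lL').2.
have := cover_inj pcov (L x); rewrite {2}LL' => inj.
have : \forall y \near x, p (L y) = p (L' y) -> L y = L' y.
  exact: (cvg_pair cL cL' inj).
by apply: filterS3 lL lL' => y [-> _] [-> _]; apply.
Qed.

Section paths.
Variable R : realType.

Lemma nbhs_interval (t : R) (P : R -> Prop) : (\forall u \near t, P u) ->
  exists2 e, 0 < e & forall u, t - e < u -> u < t + e -> P u.
Proof.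
move=> /nbhs_ballP[e /= e0 He]; exists e => // u u1 u2.
by apply: He; rewrite /ball/= ltr_norml; apply/andP; split; lra.
Qed.

(** Agreement of two lifts is an open condition by local injectivity of p, and
    so is disagreement because E is Hausdorff. *)
Lemma path_lift_unique (h : R -> B) (l l' : R -> E) :
  (forall t : R, 0 <= t <= 1 -> \forall u \near t, lifts_at h l u) ->
  (forall t : R, 0 <= t <= 1 -> \forall u \near t, lifts_at h l' u) ->
  l 0 = l' 0 -> l 1 = l' 1.
Proof.
move=> Hl Hl'; apply: (@segment_chain R (fun a b => l a = l' a -> l b = l' b)).
  by move=> a b c _ _ ab bc /ab /bc.
move=> t t01; have [e e0 He] : exists2 e, 0 < e & forall u, t - e < u ->
    u < t + e -> (l t = l' t <-> l u = l' u).
  apply: nbhs_interval; have [eqt|neqt] := pselect (l t = l' t).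
    by apply: filterS (lifts_eq_near (Hl _ t01) (Hl' _ t01) eqt) => u ->.
  have := hausdorff_neq_near (cover_hausdorff pcov)
    (nbhs_singleton (Hl _ t01)).2 (nbhs_singleton (Hl' _ t01)).2 neqt.
  by apply: filterS => u.
exists e => // a b a0 ab b1 ta bt /He-/(_ _ _)/He; apply; lra.
Qed.

Section homotopy.
Variables (X : topologicalType) (H : X * R -> B).
Hypothesis Hc : continuous H.

(** The lift is built along the segment {x0} x [0, 1] together with a
    neighbourhood of it. Two lifts along consecutive intervals are concatenated
    at their common end b, near which they agree; on a short interval, a local
    lift is moved to the prescribed starting point by a deck transformation. *)
Lemma lift_near_path (x0 : X) (e0 : E) : p e0 = H (x0, 0) ->
  exists L : X * R -> E, L (x0, 0) = e0 /\
    forall t : R, 0 <= t <= 1 -> \forall z \near (x0, t), lifts_at H L z.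
Proof.
pose Q a b := forall e, p e = H (x0, a) -> exists L : X * R -> E,
  L (x0, a) = e /\
  forall t, a <= t <= b -> \forall z \near (x0, t), lifts_at H L z.
suff : Q 0 1 by exact.
apply: segment_chain => [a b c ab bc Qab Qbc e pe|t _].
- have [L1 [L1a HL1]] := Qab _ pe.
  have L1b : p (L1 (x0, b)) = H (x0, b).
    by have /HL1/nbhs_singleton[] : a <= b <= b by rewrite ab lexx.
  have [L2 [L2b HL2]] := Qbc _ L1b.
  pose L z := if z.2 < b then L1 z else L2 z.
  exists L; split.
    rewrite /L /=; have [//|ba] := ltP a b.
    have -> : a = b by apply/le_anti/andP.
    by rewrite L2b; have -> : b = a by apply/le_anti/andP.
  have transfer (L' : X * R -> E) (z : X * R) :
      (\forall z' \near z, lifts_at H L' z') ->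
      (\forall z' \near z, L z' = L' z') -> \forall z' \near z, lifts_at H L z'.
    move=> lL' LL'; have LL2 := near_join LL'.
    apply: (filterS2 _ _ lL' LL2) => z' [pL' cL'] eqn.
    have eqz := nbhs_singleton eqn.
    split; first by rewrite eqz.
    suff cL : L @ z' --> L z' by exact: cL.
    rewrite eqz; apply: cvg_trans cL'.
    by apply: near_eq_cvg; apply: filterS eqn => ? ->.
  move=> t /andP[at_ tc]; have [tb|bt|tb] := ltgtP t b.
  + apply: (transfer L1); first by apply: HL1; rewrite at_ ltW.
    have : \forall z \near (x0, t), z.2 < b.
      have : \forall u \near t, u < b by exact: lt_nbhsl.
      by move/(@cvg_snd X R _ _ _ _); apply.
    by apply: filterS => z zb; rewrite /L zb.
  + apply: (transfer L2); first by apply: HL2; rewrite tc ltW.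
    have : \forall z \near (x0, t), b < z.2.
      have : \forall u \near t, b < u by exact: lt_nbhsr.
      by move/(@cvg_snd X R _ _ _ _); apply.
    by apply: filterS => z zb; rewrite /L ltNge ltW.
  + rewrite tb; have lL1 : \forall z \near (x0, b), lifts_at H L1 z.
      by apply: HL1; rewrite ab lexx.
    have lL2 : \forall z \near (x0, b), lifts_at H L2 z.
      by apply: HL2; rewrite bc lexx.
    apply: (transfer L1) => //.
    apply: filterS (lifts_eq_near lL1 lL2 (esym L2b)) => z zz.
    by rewrite /L; case: ifP.
- have [e pe] := cover_surj pcov (H (x0, t)).
  have [L [_ HL']] := local_lift Hc pe; have HL := near_join HL'.
  have : \forall u \near t, \forall z \near (x0, u), lifts_at H L z.
    have c : (fun u => (x0, u)) @ t --> (x0, t).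
      exact: (cvg_pair (cvg_cst x0) cvg_id).
    exact: (c _ HL).
  move=> /nbhs_interval[d d0 Hd]; exists d => // a b _ ab _ ta bt e' pe'.
  have La : p (L (x0, a)) = p e'.
    have /nbhs_singleton[-> _] : \forall z \near (x0, a), lifts_at H L z.
      by apply: Hd; lra.
    by rewrite pe'.
  have [D [Dc pD De]] := cover_deck pcov La.
  exists (D \o L); split => // u /andP[au ub].
  have : \forall z \near (x0, u), lifts_at H L z by apply: Hd; lra.
  apply: filterS => z [pL cL]; split; first by rewrite /= pD.
  by apply: continuous_comp => //; exact: Dc.
Qed.

(** The value F x is the end point of the lift along {x} x [0, 1] that starts
    at e0. Near x it is continuous because, by the uniqueness of path lifts, it
    coincides there with the end point of the lift defined around the segment
    of x. *)
Lemma lift_homotopy (b0 : B) : (forall x, H (x, 0) = b0) ->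
  exists F : X -> E, continuous F /\ forall x, p (F x) = H (x, 1).
Proof.
move=> H0; have [e0 pe0] := cover_surj pcov b0.
have HL x : exists L : X * R -> E, L (x, 0) = e0 /\
    forall t : R, 0 <= t <= 1 -> \forall z \near (x, t), lifts_at H L z.
  by apply: lift_near_path; rewrite H0.
have [L LP] := choice HL.
have L0 x : L x (x, 0) = e0 by have [] := LP x.
have Llift x (t : R) : 0 <= t <= 1 ->
    \forall z \near (x, t), lifts_at H (L x) z.
  by have [_ /(_ t)] := LP x.
have slice x (M : X * R -> E) (t : R) :
    (\forall z \near (x, t), lifts_at H M z) ->
    \forall u \near t, lifts_at (fun u => H (x, u)) (fun u => M (x, u)) u.
  move=> HM; have c (u : R) : (fun u => (x, u)) @ u --> (x, u).
    exact: (cvg_pair (cvg_cst x) cvg_id).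
  have HM2 : \forall u \near t, lifts_at H M (x, u) by exact: (c t _ HM).
  apply: filterS HM2 => u [pM cM]; split=> //.
  by apply: (@continuous_comp _ _ _ (fun u => (x, u)) M) => //; exact: c.
exists (fun x => L x (x, 1)); split; last first.
  move=> x.
  have /nbhs_singleton[//] : \forall z \near (x, 1 : R), lifts_at H (L x) z.
    by apply: Llift; rewrite ler01 lexx.
move=> x.
have lift1 : \forall z \near (x, 1 : R), lifts_at H (L x) z.
  by apply: Llift; rewrite ler01 lexx.
have lift0 : \forall z \near (x, 0 : R), lifts_at H (L x) z.
  by apply: Llift; rewrite ler01 lexx.
have inc (t : R) (y : X) : (fun y => (y, t)) @ y --> (y, t).
  exact: (cvg_pair cvg_id (cvg_cst t)).
(* The paths H (y, -) all start at b0, so the constant e0 is also a lift of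
   their starting points. *)
have base : \forall y \near x, L x (y, 0) = e0.
  have lc : \forall y \near x, lifts_at (fun=> b0) (fun y => L x (y, 0)) y.
    have lift0x : \forall y \near x, lifts_at H (L x) (y, 0).
      exact: (inc 0 x _ lift0).
    apply: filterS lift0x => y [pL cL]; split; first by rewrite pL.
    apply: (@continuous_comp _ _ _ (fun y => (y, 0)) (L x)) => //.
    exact: inc.
  have le : \forall y \near x, lifts_at (fun=> b0) (fun=> e0) y.
    by apply: filterE => y; split => //; exact: cvg_cst.
  by apply: (lifts_eq_near lc le); rewrite L0.
(* The tube lemma for the neighbourhood of {x} x [0, 1] where L x lifts H. *)
have tube : \forall y \near x, forall t : R, 0 <= t <= 1 ->
    \forall z \near (y, t), lifts_at H (L x) z.
  apply: (@segment_chain R (fun a b => \forall y \near x, forall t : R,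
    a <= t <= b -> \forall z \near (y, t), lifts_at H (L x) z)).
    move=> a b c ab bc; apply: filterS2 => y Ha Hb t /andP[at_ tc].
    by have [tb|bt] := leP t b; [apply: Ha | apply: Hb]; apply/andP;
      split => //; exact: ltW.
  move=> t t01; have := near_join (Llift x t t01).
  move=> [[U V] [/= Ux /nbhs_interval[d d0 Vd]] UV].
  exists d => // a b _ _ _ ta bt.
  apply: filterS Ux => y Uy u /andP[au ub]; apply: (UV (y, u)); split => //=.
  by apply: Vd; lra.
have eqF : \forall y \near x, L x (y, 1) = L y (y, 1).
  apply: filterS2 base tube => y By Ty.
  apply: (@path_lift_unique (fun t => H (y, t)) (fun t => L x (y, t))
    (fun t => L y (y, t))); last by rewrite By L0.
  - by move=> t t01; apply: slice; exact: Ty.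
  - by move=> t t01; apply: slice; exact: Llift.
have cx : (fun y => L x (y, 1)) @ x --> L x (x, 1).
  apply: (@continuous_comp X _ _ (fun y => (y, 1 : R)) (L x)); first exact: inc.
  by have [] := nbhs_singleton lift1.
apply: cvg_trans cx; apply: near_eq_cvg; exact: eqF.
Qed.

End homotopy.

Section contractible.
Variables (X : topologicalType) (c : X * R -> X) (x0 : X).
Hypotheses (c_cont : continuous c) (c0 : forall x, c (x, 0) = x0)
  (c1 : forall x, c (x, 1) = x).

Lemma lift_exists (h : X -> B) : continuous h ->
  exists F : X -> E, continuous F /\ forall x, p (F x) = h x.
Proof.
move=> hc; have [||F [Fc pF]] := @lift_homotopy X (h \o c) _ (h x0).
- by move=> z; apply: continuous_comp; [exact: c_cont | exact: hc].
- by move=> x /=; rewrite c0.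
by exists F; split => // x; rewrite pF /= c1.
Qed.

(** The paths of the contraction join x0 to every point, which reduces the
    claim to the uniqueness of path lifts. *)
Lemma lift_unique (F F' : X -> E) : continuous F -> continuous F' ->
  (forall x, p (F x) = p (F' x)) -> F x0 = F' x0 -> F =1 F'.
Proof.
move=> Fc F'c pF F0 x; rewrite -(c1 x).
have inc (t : R) : (fun t => c (x, t)) @ t --> c (x, t).
  apply: (@continuous_comp _ _ _ (fun t => (x, t)) c); last exact: c_cont.
  exact: (cvg_pair (cvg_cst x) cvg_id).
apply: (@path_lift_unique (fun t => p (F (c (x, t)))) (fun t => F (c (x, t)))
  (fun t => F' (c (x, t)))); last by rewrite !c0.
- move=> t _; apply: filterE => u; split => //.
  apply: (@continuous_comp _ _ _ (fun t => c (x, t)) F); last exact: Fc.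
  exact: inc.
- move=> t _; apply: filterE => u; split; first by rewrite pF.
  apply: (@continuous_comp _ _ _ (fun t => c (x, t)) F'); last exact: F'c.
  exact: inc.
Qed.

End contractible.
End paths.
End covering.

(** * Quotients of G by discrete subgroups *)

Section G.
Variable R : realType.
Local Notation V := (R * (R * 'cV[R]_6))%type.

Lemma G_hausdorff : hausdorff_space (G R).
Proof. exact: (@norm_hausdorff _ V). Qed.

(** The radial contraction of G, taken in the vector space R^8 that underlies
    it. *)
Definition shrink (z : G R * R) : G R := z.2 *: (z.1 : V).

Lemma shrink_continuous : continuous shrink.
Proof.
move=> [x t]; apply: (@cvgZ _ V) => /=; first exact: cvg_snd.
exact: cvg_fst.
Qed.

Lemma mx_continuous (T : topologicalType) m n (f : T -> 'M[R]_(m, n)) :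
  (forall i j, continuous (fun x => f x i j)) -> continuous f.
Proof.
move=> fc x A [P PM PA].
have : \forall y \near x, forall i j, P i j (f y i j).
  apply: filter_forall => i; apply: filter_forall => j.
  exact: (fc i j x _ (PM i j)).
by apply: filterS => y; exact: PA.
Qed.

Lemma mulmx_continuous m n p (A : 'M[R]_(m, n)) :
  continuous (mulmx A : 'M[R]_(n, p) -> 'M[R]_(m, p)).
Proof.
apply: mx_continuous => i k.
have -> : (fun B : 'M[R]_(n, p) => (A *m B) i k) =
    (fun B : 'M[R]_(n, p) => \sum_j A i j * B j k).
  by apply/funext => B; rewrite mxE.
apply: continuous_big => [|j _ B]; first exact: add_continuous.
apply: (@continuous_comp 'M[R]_(n, p) R R (fun B => B j k) ( *%R (A i j))).
  exact: coord_continuous.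
exact: mulrl_continuous.
Qed.

Lemma mulg_continuous (l : G R) : continuous (fun x : G R => (l * x)%g).
Proof.
move=> x.
have c1 : (fun y : G R => y.1) @ x --> x.1 by exact: cvg_fst.
have c2 : (fun y : G R => y.2) @ x --> x.2 by exact: cvg_snd.
have h1 (h : H R) : (fun y : H R => y.1) @ h --> h.1 by exact: cvg_fst.
have h2 (h : H R) : (fun y : H R => y.2) @ h --> h.2 by exact: cvg_snd.
have c21 : (fun y : G R => y.2.1) @ x --> x.2.1 := cvg_comp _ _ c2 (h1 x.2).
have c22 : (fun y : G R => y.2.2) @ x --> x.2.2 := cvg_comp _ _ c2 (h2 x.2).
have c22' : (fun y : G R => phi l.2.1 *m (Defs.rot l.1 *m y.2.2)) @ x -->
    phi l.2.1 *m (Defs.rot l.1 *m x.2.2).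
  have r : (fun y : G R => Defs.rot l.1 *m y.2.2) @ x --> Defs.rot l.1 *m x.2.2.
    exact: (cvg_comp _ _ c22 (@mulmx_continuous _ _ _ _ _)).
  exact: (cvg_comp _ _ r (@mulmx_continuous _ _ _ _ _)).
exact: (cvg_pair (cvgD (cvg_cst l.1) c1)
  (cvg_pair (cvgD (cvg_cst l.2.1) c21) (cvgD (cvg_cst l.2.2) c22'))).
Qed.

Section quotient.
Variables (L : set (G R)) (Lg : group_closed [in L]).
Local Notation M := (lquot Lg).
Let p : G R -> M := \pi_M.

(** The deck transformations are the left translations by L. The saturation of
    an open set is a union of preimages of it under translations, so the
    projection is open. The hypothesis makes it locally injective. *)
Lemma lquot_covering :
  (forall e : G R, \forall u \near (e, e),
    forall l, L l -> u.2 = (l * u.1)%g -> u.1 = u.2) ->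
  regular_covering p.
Proof.
move=> Ldisc; split.
- exact: pi_continuous.
- move=> U Uo; have -> : open (p @` U) = open (p @^-1` (p @` U)) by [].
  have -> : p @^-1` (p @` U) = \bigcup_(l in L) ((fun x => (l * x)%g) @^-1` U).
    apply/seteqP; split => [x [u Uu /esym/lquotP[l Ll ul]]|x [l Ll Ulx]].
      by exists l => //=; rewrite -ul.
    by exists (l * x)%g => //; apply/esym/lquotP; exists l.
  apply: bigcup_open => l _; apply: open_comp => // x _; exact: mulg_continuous.
- by move=> b; exists (repr b); rewrite /p reprK.
- move=> e; apply: filterS (Ldisc e) => u Hu /lquotP[l Ll ul]; exact: (Hu l).
- move=> e e' /lquotP[l Ll el]; exists (fun x => (l * x)%g); split => //.
    exact: mulg_continuous.
  by move=> u; apply/esym/lquotP; exists l.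
- exact: G_hausdorff.
Qed.

End quotient.

Lemma shrink0 x : shrink (x, 0) = 1%g.
Proof. exact: (@scale0r R V x). Qed.

Lemma shrink1 x : shrink (x, 1) = x.
Proof. exact: (@scale1r R V x). Qed.

Section monodromy.
Variables (L L' : set (G R)).
Variables (Lg : group_closed [in L]) (L'g : group_closed [in L']).
Local Notation M := (lquot Lg).
Local Notation M' := (lquot L'g).
Hypothesis (cov' : regular_covering (\pi_M' : G R -> M')).

(** For l in L, the maps sending x to F (l x) and to theta (l) F x both lift
    f \o \pi, so they are equal as soon as they agree at 1. This determines
    theta (l). *)
Lemma equivariant_lift (f : M -> M') : continuous f ->
  exists F theta, [/\ continuous F, forall x, \pi_M' (F x) = f (\pi_M x) &
    forall l, L l -> L' (theta l) /\ forall x, F (l * x)%g = (theta l * F x)%g].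
Proof.
move=> fc.
have fpc : continuous (f \o \pi_M).
  by move=> x; apply: continuous_comp; [exact: pi_continuous | exact: fc].
have [F [Fc pF]] := lift_exists cov' shrink_continuous shrink0 shrink1 fpc.
exists F, (fun l => F l * (F 1)^-1)%g; split => // l Ll.
have pl x : \pi_M (l * x)%g = \pi_M x by apply/esym/lquotP; exists l.
have L'l : L' (F l * (F 1)^-1)%g.
  have : \pi_M' (F 1%g) = \pi_M' (F l) by rewrite !pF /= -(pl 1%g) mulg1.
  by move=> /lquotP[l' L'l' ->]; rewrite mulgK.
split=> //.
apply: (lift_unique cov' shrink_continuous shrink0 shrink1).
- move=> x.
  apply: (@continuous_comp _ _ _ (fun x => (l * x)%g) F); last exact: Fc.
  exact: mulg_continuous.
- move=> x; apply: (@continuous_comp _ _ _ F (fun y => (F l * (F 1)^-1 * y)%g)).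
    exact: Fc.
  exact: mulg_continuous.
- move=> x; rewrite pF /= pl; transitivity (\pi_M' (F x)); first by rewrite pF.
  by apply/lquotP; eexists; first exact: L'l.
- by rewrite mulg1 mulgVK.
Qed.

End monodromy.

(** If F and F' lift the homeomorphism and its inverse, then F \o F' lifts the
    identity and is therefore the translation by some c in L'. Hence
    theta \o theta' is the conjugation by c, and theta is onto. *)
Lemma homeomorphic_lquot (L L' : set (G R))
    (Lg : group_closed [in L]) (L'g : group_closed [in L']) :
  regular_covering (\pi_(lquot Lg) : G R -> lquot Lg) ->
  regular_covering (\pi_(lquot L'g) : G R -> lquot L'g) ->
  homeomorphic (lquot Lg) (lquot L'g) ->
  exists theta : G R -> G R, [/\ forall l, L l -> L' (theta l),
    forall l k, L l -> L k -> theta (l * k)%g = (theta l * theta k)%g &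
    forall l', L' l' -> exists2 l, L l & theta l = l'].
Proof.
move=> cov cov' [f [g [fc gc fK gK]]].
have [F [th [Fc pF Fth]]] := equivariant_lift cov' fc.
have [F' [th' [F'c pF' F'th]]] := equivariant_lift cov gc.
have L'mul l l' : L' l -> L' l' -> L' (l * l')%g.
  by have := group_closedM L'g => /(_ l l'); rewrite !inE.
have L'V l : L' l -> L' l^-1%g.
  by have := group_closedV L'g => /(_ l); rewrite !inE.
exists th; split.
- by move=> l /Fth[].
- move=> l k Ll Lk; apply: (@mulIg _ (F 1%g)).
  have Llk : L (l * k)%g.
    by have := group_closedM Lg => /(_ l k); rewrite !inE; apply.
  rewrite -(Fth _ Llk).2 -!mulgA (Fth _ Ll).2 (Fth _ Lk).2 //.
- have pFF' x : \pi_(lquot L'g) x = \pi_(lquot L'g) (F (F' x)).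
    by rewrite pF pF' gK.
  have /lquotP[c L'c Fc1] := pFF' 1%g; rewrite mulg1 in Fc1.
  have FF' : (fun x => F (F' x)) =1 (fun x => c * x)%g.
    apply: (lift_unique cov' shrink_continuous shrink0 shrink1).
    + by move=> x; apply: continuous_comp; [exact: F'c | exact: Fc].
    + exact: mulg_continuous.
    + by move=> x; rewrite -pFF'; apply/lquotP; exists c.
    + by rewrite mulg1.
  move=> l' L'l'.
  have L'k : L' (c^-1 * l' * c)%g.
    by apply: (L'mul) => //; apply: (L'mul) => //; exact: L'V.
  exists (th' (c^-1 * l' * c)%g); first by have [] := F'th _ L'k.
  have [Lth' F'E] := F'th _ L'k.
  apply: (@mulIg _ c).
  have := (Fth _ Lth').2 (F' 1%g); rewrite -F'E Fc1 => <-.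
  by rewrite [LHS]FF' mulg1 !mulgA mulgV mul1g.
Qed.

End G.

(** * Discreteness of the lattices *)

Section lattice.
Variables (R : realType) (m : nat) (m_gt2 : (2 < m)%N).
Local Notation V := (R * (R * 'cV[R]_6))%type.
Local Notation tau := (tm R m).

Lemma Qm_unit : Qm R m \in unitmx.
Proof.
have [t0 _] := tmE R m_gt2.
pose r : 'rV[R]_3 := \row_(i < 3) [:: expR tau; expR (- tau); 1]`_i.
have -> : Qm R m = (Vandermonde 3 r)^T.
  apply/matrixP => -[[|[|[|//]]] ?] [[|[|[|//]]] ?];
    rewrite !mxE /= ?expr0 ?expr1 ?expr1n //.
    by rewrite expRM_natl.
  by rewrite -mulrN expRM_natl.
rewrite unitmx_tr unitmxE det_Vandermonde unitfE.
have e1 : 1 < expR tau by rewrite expR_gt1.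
have e2 : expR (- tau) < 1 by rewrite expR_lt1 oppr_lt0.
apply/prodf_neq0 => -[[|[|[|//]]] ?] _;
  apply/prodf_neq0 => -[[|[|[|//]]] ?] //= _;
  rewrite !mxE /= subr_eq0; apply/eqP => E; move: E e1 e2; lra.
Qed.

Lemma Pm_unit : Pm R m \in unitmx.
Proof.
have : \det (block_mx (Qm R m) 0 0 (Qm R m)) \is a GRing.unit.
  by rewrite det_ublock unitrM -!unitmxE Qm_unit.
by rewrite -unitmxE.
Qed.

Lemma intr_mul_lt_eq0 (k : int) (a : R) : `|k%:~R * a| < a -> k = 0.
Proof.
move=> ka; have a0 : 0 < a by apply: le_lt_trans ka.
move: ka; rewrite normrM (gtr0_norm a0) -ltr_pdivlMr // divff ?gt_eqF //.
rewrite -intr_norm -[ltRHS]mulr1z ltr_int => k1; apply/eqP.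
by rewrite -normr_le0 -ltzD1 add0r.
Qed.

(** The coordinates of the lattice element are recovered from u.2 - u.1: they
    are integral multiples of 2 pi and t_m and, after multiplication by the
    inverse of P_m, integers. If they are small then they vanish, one after
    the other, so that phi and R act trivially when the vector part is
    reached. *)
Lemma Lambda_discrete (e : G R) : \forall u \near (e, e),
  forall l, Lambda m l -> u.2 = (l * u.1)%g -> u.1 = u.2.
Proof.
have [t0 _] := tmE R m_gt2.
have pi0 : 0 < 2 * pi :> R by rewrite mulr_gt0 ?pi_gt0.
pose W := [set y : G R | `|y.1| < 2 * pi /\ `|y.2.1| < tau /\
  forall i j, `|(invmx (Pm R m) *m y.2.2) i j| < 1].
have W0 (o : G R) : o = (0, (0, 0)) -> nbhs o W.
  move=> o0.
  have small (f : G R -> R) (a : R) : f @ o --> f o -> f o = 0 -> 0 < a ->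
      nbhs o [set y : G R | `|f y| < a].
    move=> /cvgrPdist_lt fc fo a0; apply: filterS (fc _ a0) => y.
    by rewrite fo sub0r normrN.
  have c1 : (fun y : G R => y.1) @ o --> o.1 by exact: cvg_fst.
  have c2 : (fun y : G R => y.2) @ o --> o.2 by exact: cvg_snd.
  have h1 (h : H R) : (fun y : H R => y.1) @ h --> h.1 by exact: cvg_fst.
  have h2 (h : H R) : (fun y : H R => y.2) @ h --> h.2 by exact: cvg_snd.
  have c21 : (fun y : G R => y.2.1) @ o --> o.2.1.
    exact: (cvg_comp _ _ c2 (h1 _)).
  have c22 : (fun y : G R => y.2.2) @ o --> o.2.2.
    exact: (cvg_comp _ _ c2 (h2 _)).
  have W3 i j : nbhs o [set y : G R | `|(invmx (Pm R m) *m y.2.2) i j| < 1].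
    apply: small => //; last by rewrite o0 mulmx0 mxE.
    have c := cvg_comp _ _ c22 (@mulmx_continuous R _ _ _ (invmx (Pm R m)) _).
    exact: (cvg_comp _ _ c (@coord_continuous R _ _ i j _)).
  have W3' : nbhs o
      [set y : G R | forall i j, `|(invmx (Pm R m) *m y.2.2) i j| < 1].
    exact: (filter_forall (nbhs_filter o)
      (fun i => filter_forall (nbhs_filter o) (W3 i))).
  have W1 : nbhs o [set y : G R | `|y.1| < 2 * pi].
    by apply: small => //; rewrite o0.
  have W2 : nbhs o [set y : G R | `|y.2.1| < tau].
    by apply: small => //; rewrite o0.
  exact: filterI W1 (filterI W2 W3').
pose D (u : G R * G R) : G R := (u.2 : V) - (u.1 : V).
have Dc : D @ (e, e) --> D (e, e).
  have d1 : (fun u : V * V => u.1) @ ((e : V), (e : V)) --> (e : V).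
    exact: cvg_fst.
  have d2 : (fun u : V * V => u.2) @ ((e : V), (e : V)) --> (e : V).
    exact: cvg_snd.
  exact: (cvgB d2 d1).
have WD : nbhs (e, e) (D @^-1` W) by exact: (Dc _ (W0 _ (subrr (e : V)))).
apply: (@filterS _ _ (nbhs_filter (e, e)) _ _ _ WD).
move=> [[s [t v]] [s' [t' v']]].
move=> [/= W1 [W2 W3]] [_ [_ _]] [[k /= ->] [[j /= ->] [z /= ->]]].
move=> [s'E t'E]; move: W1 W2; rewrite s'E t'E !addrK.
move=> /intr_mul_lt_eq0 k0 /intr_mul_lt_eq0 j0; rewrite k0 j0 !mul0r !add0r.
rewrite phi0 Defs.rot0 !mul1mx => v'E.
move: W3; rewrite v'E addrK mulKmx ?Pm_unit // => W3.
suff -> : z = 0 by rewrite map_mx0 mulmx0 add0r.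
apply/matrixP => i i'; have := W3 i i'; rewrite !mxE -[X in `|X|]mulr1.
exact: intr_mul_lt_eq0.
Qed.

End lattice.

(** * The algebra of the lattices *)

Section Lambda_algebra.
Variables (R : realType) (m : nat) (m_gt2 : (2 < m)%N).
Implicit Types a b c g x y : G R.

Lemma phiE (t : R) (v : 'cV[R]_6) : phi t *m v =
  \col_i ([:: expR t; expR (- t); 1; expR t; expR (- t); 1]`_i * v i 0).
Proof. by apply/colP => i; rewrite /phi mul_diag_mx !mxE. Qed.

(** The rotation by a multiple of 2 pi is trivial. *)
Lemma Lambda_mul x y : Lambda m x ->
  (x * y)%g = (x.1 + y.1, (x.2.1 + y.2.1, x.2.2 + phi x.2.1 *m y.2.2)).
Proof.
case: x => s [t v] [[k /= ->] _].
by congr (_, (_, _)); rewrite /= rot2piz mul1mx.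
Qed.

Lemma Lambda_closedM x y : Lambda m x -> Lambda m y -> Lambda m (x * y)%g.
Proof.
by have := group_closedM (Lambda_group R m_gt2) => /(_ x y); rewrite !inE.
Qed.

Lemma Lambda_closedV x : Lambda m x -> Lambda m x^-1%g.
Proof.
by have := group_closedV (Lambda_group R m_gt2) => /(_ x); rewrite !inE.
Qed.

Lemma Lambda_closed1 : Lambda m (1%g : G R).
Proof. by have [] := Lambda_group R m_gt2; rewrite inE. Qed.

Lemma Lambda_closedX x k : Lambda m x -> Lambda m (x ^+ k)%g.
Proof.
move=> Lx; elim: k => [|k IH]; first exact: Lambda_closed1.
by rewrite expgS; exact: Lambda_closedM.
Qed.

Lemma Lambda_expg x k : Lambda m x -> x.2.1 = 0 ->
  (x ^+ k)%g = (x.1 *+ k, (0, x.2.2 *+ k)).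
Proof.
move=> Lx x0; elim: k => [|k IH]; first by rewrite !mulr0n.
by rewrite expgS IH Lambda_mul //= x0 add0r phi0 mul1mx !mulrS.
Qed.

(** The equation says that c is the commutator a b a^-1 b^-1. Conjugates are
    described in the same way in the next lemma: without inverses, the
    equations are preserved by any multiplicative map. *)
Lemma Lambda_commutator a b c : Lambda m a -> Lambda m b -> Lambda m c ->
  (a * b = c * (b * a))%g ->
  [/\ c.1 = 0, c.2.1 = 0 & c.2.2 =
    (a.2.2 + phi a.2.1 *m b.2.2) - (b.2.2 + phi b.2.1 *m a.2.2)].
Proof.
move=> La Lb Lc.
rewrite (Lambda_mul (b * a)%g Lc) (Lambda_mul a Lb) (Lambda_mul b La).
move=> [/= E1 E2 E3].
have c1 : c.1 = 0 by apply: (addIr (b.1 + a.1)); rewrite -E1 add0r addrC.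
have c2 : c.2.1 = 0 by apply: (addIr (b.2.1 + a.2.1)); rewrite -E2 add0r addrC.
by split => //; rewrite E3 c2 phi0 mul1mx addrK.
Qed.

Lemma Lambda_conj g c c' : Lambda m g -> Lambda m c' -> c.2.1 = 0 ->
  (g * c = c' * g)%g ->
  [/\ c'.1 = c.1, c'.2.1 = 0 & c'.2.2 = phi g.2.1 *m c.2.2].
Proof.
move=> Lg Lc' c0; rewrite (Lambda_mul c Lg) (Lambda_mul g Lc') c0 addr0.
move=> [/= E1 E2 E3].
have c1 : c'.1 = c.1 by apply: (addIr g.1); rewrite -E1 addrC.
have c2 : c'.2.1 = 0 by apply: (addIr g.2.1); rewrite -E2 add0r.
split => //; apply: (addIr g.2.2).
by move: E3; rewrite c2 phi0 mul1mx => <-; rewrite addrC.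
Qed.

Definition gen_t : G R := (0, (tm R m, 0)).

Lemma gen_t_Lambda : Lambda m gen_t.
Proof.
split; first by exists 0; rewrite mul0r.
by split; [exists 1; rewrite mul1r | exists 0; rewrite map_mx0 mulmx0].
Qed.

(** Here c1 = g c g^-1 and c2 = g^2 c g^-2 for g = gen_t and a commutator c.
    Conjugation by g acts on the vector c as phi t_m, whose eigenvalues on the
    span of the commutators are the two roots of X^2 - m X + 1. *)
Lemma gen_t_charpoly a b c c1 c2 :
  Lambda m a -> Lambda m b -> Lambda m c -> Lambda m c1 -> Lambda m c2 ->
  (a * b = c * (b * a))%g -> (gen_t * c = c1 * gen_t)%g ->
  (gen_t * c1 = c2 * gen_t)%g -> (c2 * c = c1 ^+ m)%g.
Proof.
move=> La Lb Lc Lc1 Lc2 abc gc gc1.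
have [s0 t0 v0] := Lambda_commutator La Lb Lc abc.
have [s1 t1 v1] := Lambda_conj gen_t_Lambda Lc1 t0 gc.
have [s2 t2 v2] := Lambda_conj gen_t_Lambda Lc2 t1 gc1.
rewrite Lambda_expg // Lambda_mul // t2 t0 phi0 mul1mx s2 s1 s0 !addr0 mul0rn.
congr (_, (_, _)); rewrite v2 v1 /=; move: v0; move: (c.2.2) => v v0.
have [_ em] := tmE R m_gt2; have ee := expRxMexpNx_1 (tm R m).
move: v0; rewrite !phiE => /colP v0; apply/colP => i; move: (v0 i).
rewrite mulmxnE !mxE -mulr_natl -em.
(* In the third and sixth coordinates phi is trivial, so that those of the
   commutator vanish. *)
case: i => [[|[|[|[|[|[|//]]]]]] ?] /=; rewrite ?mul1r; move: ee;
  move: (expR _) (expR _) => p q;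
  move: (v _ _) (a.2.2 _ _) (b.2.2 _ _) => r u w.
- by move=> ee _; ring: ee.
- by move=> ee _; ring: ee.
- by move=> _ ->; ring.
- by move=> ee _; ring: ee.
- by move=> ee _; ring: ee.
- by move=> _ ->; ring.
Qed.

(** Its commutator with gen_t has first coordinate e^t_m - 1, which is not 0
    and so detects the eigenvalue of phi on the first axis. *)
Definition gen_v : G R := (0, (0, Pm R m *m delta_mx 0 0)).

Lemma gen_v_Lambda : Lambda m gen_v.
Proof.
split; first by exists 0; rewrite mul0r.
split; first by exists 0; rewrite mul0r.
by exists (delta_mx 0 0); rewrite map_delta_mx.
Qed.

Lemma gen_v0 : gen_v.2.2 0 0 = 1.
Proof.
rewrite /= -colE mxE /Pm mxE; case: splitP => i //= i0.
rewrite mxE; case: splitP => j //= j0.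
by rewrite mxE -i0 -j0.
Qed.

End Lambda_algebra.

(** With x = e^s and y = e^t, this is the monotonicity of cosh. *)
Lemma le_addrV (R : realType) (x y : R) : 1 < x -> x <= y ->
  x + x^-1 <= y + y^-1.
Proof.
move=> x1 xy; have x0 : 0 < x by lra. have y0 : 0 < y by lra.
rewrite -subr_ge0.
have -> : y + y^-1 - (x + x^-1) = (y - x) * (x * y - 1) / (x * y).
  by field; rewrite ?gt_eqF.
by rewrite divr_ge0 ?mulr_ge0 ?subr_ge0 ?(ltW x0) ?(ltW y0) //; nra.
Qed.

(** The images of gen_t and of a commutator that maps to the one of gen_t and
    gen_v satisfy the relation of gen_t_charpoly in Lambda_n; its first
    coordinate reads x^2 + 1 = m x with x = e^(j t_n) for some integer j. *)
Lemma Lambda_epi_leq (R : realType) (m n : nat)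
    (m_gt2 : (2 < m)%N) (n_gt2 : (2 < n)%N) (theta : G R -> G R) :
  (forall l, Lambda m l -> Lambda n (theta l)) ->
  (forall l k, Lambda m l -> Lambda m k ->
    theta (l * k)%g = (theta l * theta k)%g) ->
  (forall l', Lambda n l' -> exists2 l, Lambda m l & theta l = l') ->
  (n <= m)%N.
Proof.
move=> thL thM thS.
have LM := @Lambda_closedM R m m_gt2; have LV := @Lambda_closedV R m m_gt2.
have thX x k : Lambda m x -> theta (x ^+ k)%g = (theta x ^+ k)%g.
  move=> Lx; elim: k => [|k IH].
    have L1 := @Lambda_closed1 R m m_gt2.
    by apply: (mulIg (theta 1%g)); rewrite -thM ?mul1g.
  by rewrite !expgS thM ?IH //; exact: Lambda_closedX.
have [a La tha] := thS _ (gen_t_Lambda R n).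
have [b Lb thb] := thS _ (gen_v_Lambda R n).
have Lg := gen_t_Lambda R m; set g := gen_t R m in Lg.
have quot (x y : G R) : Lambda m x -> Lambda m y ->
    exists2 z, Lambda m z & y = (z * x)%g.
  move=> Lx Ly; exists (y * x^-1)%g; last by rewrite mulgVK.
  by apply: (LM) => //; apply: (LV).
have Lba := LM _ _ Lb La.
have [c Lc abc] := quot _ _ Lba (LM _ _ La Lb).
have [c1 Lc1 gc] := quot _ _ Lg (LM _ _ Lg Lc).
have [c2 Lc2 gc1] := quot _ _ Lg (LM _ _ Lg Lc1).
have cm := gen_t_charpoly m_gt2 La Lb Lc Lc1 Lc2 abc gc gc1.
move: (congr1 theta abc) (congr1 theta gc) (congr1 theta gc1) (congr1 theta cm).
rewrite !thM // thX // tha thb.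
have Lc' := thL _ Lc; have Lc1' := thL _ Lc1; have Lc2' := thL _ Lc2.
move: (theta c) (theta c1) (theta c2) (thL _ Lg) Lc' Lc1' Lc2'.
move=> d d1 d2 Lh Ld Ld1 Ld2.
move: (theta g) Lh => h Lh dE hd hd1 dn.
have [s0 t0 v0] :=
  Lambda_commutator (gen_t_Lambda R n) (gen_v_Lambda R n) Ld dE.
have [s1 t1 v1] := Lambda_conj Lh Ld1 t0 hd.
have [s2 t2 v2] := Lambda_conj Lh Ld2 t1 hd1.
move: dn; rewrite (Lambda_expg _ Ld1) // (Lambda_mul d Ld2).
rewrite t2 t0 phi0 mul1mx => -[_ _].
have [_ [[j hj] _]] := Lh.
rewrite v2 v1 hj => /(congr1 (fun u : 'cV[R]_6 => u 0 0)).
have d0 : d.2.2 0 0 = expR (tm R n) - 1.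
  have := gen_v0 R n; rewrite v0 !phiE !mxE /= => ->; rewrite ?mxE; ring.
rewrite !phiE mulmxnE !mxE /= d0 => E.
have [t_gt0 tn] := tmE R n_gt2.
have et1 : 1 < expR (tm R n) by rewrite expR_gt1.
set x := expR (j%:~R * tm R n) in E.
have x0 : 0 < x by exact: expR_gt0.
have mx : m%:R = x + x^-1.
  apply: (mulIf (lt0r_neq0 x0)); rewrite mulrDl mulVf ?lt0r_neq0 //.
  apply: (@mulIf _ (expR (tm R n) - 1)); first by rewrite subr_eq0 gt_eqF.
  by rewrite -mulrA mulr_natl -E; ring.
rewrite -(@ler_nat R) mx -tn expRN.
case: (ltgtP j 0) => [j0|j0|j0].
- rewrite [leRHS]addrC -[X in _ <= _ + X]invrK; apply: le_addrV => //.
  rewrite /x -expRN ler_expR -mulNr -rmorphN /= ler_peMl ?(ltW t_gt0) //.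
  by rewrite -[1]/(1%:~R) ler_int; move: j0; rewrite -oppr_gt0 -gtz0_ge1.
- apply: le_addrV => //.
  rewrite /x ler_expR ler_peMl ?(ltW t_gt0) //.
  by rewrite -[1]/(1%:~R) ler_int -gtz0_ge1.
- have m2R : (2 : R) < m%:R by rewrite ltr_nat.
  by move: m2R; rewrite mx /x j0 mul0r expR0 invr1; lra.
Qed.

Lemma Lambda_covering (R : realType) (m : nat) (m_gt2 : (2 < m)%N) :
  regular_covering (\pi_(lquot (Lambda_group R m_gt2)) :
    G R -> lquot (Lambda_group R m_gt2)).
Proof. by apply: lquot_covering => e; exact: Lambda_discrete. Qed.

Theorem proposition5p1 (R : realType) (m n : nat)
    (m_gt2 : (2 < m)%N) (n_gt2 : (2 < n)%N) :
  m <> n -> ~ homeomorphic (solvmanifold R m_gt2) (solvmanifold R n_gt2).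
Proof.
move=> mn mn_homeo; apply: mn; apply/eqP; rewrite eqn_leq; apply/andP.
have [f [g [fc gc fK gK]]] := mn_homeo.
have nm_homeo : homeomorphic (solvmanifold R n_gt2) (solvmanifold R m_gt2).
  by exists g, f.
have covm := Lambda_covering R m_gt2; have covn := Lambda_covering R n_gt2.
have [th [thL thM thS]] := homeomorphic_lquot covm covn mn_homeo.
have [th' [th'L th'M th'S]] := homeomorphic_lquot covn covm nm_homeo.
split; [exact: (Lambda_epi_leq n_gt2 m_gt2 th'L th'M th'S)|].
exact: (Lambda_epi_leq m_gt2 n_gt2 thL thM thS).
Qed.
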